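(* Let $K$ be an algebraically closed field of characteristic $0$, let $C\subset\mathbb{P}^2$ be a smooth plane curve over $K$ of degree $d\ge 4$, and let $P\in\mathbb{P}^2$. Assume that $n$ is an odd prime and $\deg\pi_P=2n$. Then $|G[P]|=n$ if and only if $G_P\cong(\mathbb{Z}/n\mathbb{Z})\times D_{2n}$.
   Context: $\pi_P:C\dashrightarrow\mathbb{P}^1$ is the projection from $P$, $Q\mapsto\overline{PQ}$. $G[P]=\{\tau\in\mathrm{Bir}(C)\mid \pi_P\circ\tau=\pi_P\}$. $G_P=\mathrm{Gal}(L_P/\pi_P^*K(\mathbb{P}^1))$, where $L_P$ is the Galois closure of the field extension $K(C)/\pi_P^*K(\mathbb{P}^1)$. $D_{2n}$ denotes the dihedral group of order $2n$. *)

(* Defs.v *)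
From HB Require Import structures.
From mathcomp Require Import all_boot all_order all_algebra.
From mathcomp Require Import all_fingroup all_solvable all_field.
From mathcomp Require Export mpoly.

Set Implicit Arguments.
Unset Strict Implicit.
Unset Printing Implicit Defensive.

Import GRing.Theory.
Local Open Scope ring_scope.

Section PlaneCurve.

Variable K : closedFieldType.

Definition smooth_plane_curve (d : nat) (F : {mpoly K[3]}) : Prop :=
  [/\ F \is d.-homog, F != 0 &
      forall Q : 'rV[K]_3, Q != 0 -> F.@[fun i => Q 0 i] = 0 ->
        exists i : 'I_3, (F^`M(i)).@[fun i => Q 0 i] != 0].

Definition in_ideal (F G : {mpoly K[3]}) : Prop := exists H, G = H * F.

(* A rational map from C = (F = 0) to the projective space of dimension m - 1
   is represented by m forms of the same degree, not all zero on C; two such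
   families represent the same rational map iff they are proportional on C.   *)
Definition is_ratmap (F : {mpoly K[3]}) m (T : m.-tuple {mpoly K[3]}) : Prop :=
  (exists e : nat, forall i, tnth T i \is e.-homog) /\
  (exists i, ~ in_ideal F (tnth T i)).

Definition ratmap_eq F m (T S : m.-tuple {mpoly K[3]}) : Prop :=
  [/\ is_ratmap F T, is_ratmap F S &
      forall i j, in_ideal F (tnth T i * tnth S j - tnth T j * tnth S i)].

(* [T \o S] *)
Definition ratmap_comp m (T : m.-tuple {mpoly K[3]})
    (S : 3.-tuple {mpoly K[3]}) : m.-tuple {mpoly K[3]} :=
  [tuple tnth T i \mPo S | i < m].

Definition ratmap_id : 3.-tuple {mpoly K[3]} := [tuple 'X_i | i < 3].

Definition rat_selfmap F (T : 3.-tuple {mpoly K[3]}) : Prop :=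
  is_ratmap F T /\ in_ideal F (F \mPo T).

(* Representatives of the elements of Bir(C). *)
Definition birational F (T : 3.-tuple {mpoly K[3]}) : Prop :=
  rat_selfmap F T /\
  exists S, [/\ rat_selfmap F S,
                ratmap_eq F (ratmap_comp T S) ratmap_id &
                ratmap_eq F (ratmap_comp S T) ratmap_id].

(* A full-rank M killing P identifies the pencil of lines through P with the
   projective line: the lines PQ and PQ' coincide iff Q *m M and Q' *m M are
   proportional. The projection from P is then Q |-> Q *m M.                  *)
Definition pencil_coordinates (P : 'rV[K]_3) (M : 'M[K]_(3, 2)) : Prop :=
  P *m M = 0 /\ \rank M = 2.

Definition projection (M : 'M[K]_(3, 2)) : 2.-tuple {mpoly K[3]} :=
  [tuple \sum_(j < 3) M j i *: 'X_j | i < 2].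

(* Representatives of the elements of G[P]. *)
Definition in_GP F M (T : 3.-tuple {mpoly K[3]}) : Prop :=
  birational F T /\ ratmap_eq F (ratmap_comp (projection M) T) (projection M).

(* G[P], as a set of rational maps (not of representatives), has n elements. *)
Definition card_GP F M (n : nat) : Prop :=
  exists s : 'I_n -> 3.-tuple {mpoly K[3]},
    [/\ forall k, in_GP F M (s k),
        forall k l, ratmap_eq F (s k) (s l) -> k = l &
        forall T, in_GP F M T -> exists k, ratmap_eq F T (s k)].

(* The function field K(t) of the projective line, t being the quotient of the
   first homogeneous coordinate by the second one.                            *)
Definition ratfun : fieldType := {fraction {poly K}}.

Definition ratfun_t : ratfun := tofrac 'X.

Section Extensions.

Variable L : splittingFieldType ratfun.

Definition const_emb (c : K) : L := (tofrac c%:P : ratfun)%:A.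

Definition eval_at (xi : 'I_3 -> L) (G : {mpoly K[3]}) : L :=
  mmap const_emb xi G.

(* E is the function field K(C), made into an extension of K(t) through the
   pullback by the projection. Here xi is a vector of homogeneous coordinates
   of the generic point of C: the forms vanishing at xi are those vanishing on
   C, and E consists of the values at xi of the quotients of two forms of the
   same degree. The last clause says that t pulls back to the quotient of the
   two components of the projection. In particular, \dim E is the degree of
   the projection.                                                            *)
Definition function_field_via_projection F (M : 'M[K]_(3, 2))
    (E : {subfield L}) (xi : 'I_3 -> L) : Prop :=
  [/\ forall (e : nat) (G : {mpoly K[3]}), G \is e.-homog ->
        eval_at xi G = 0 <-> in_ideal F G,
      forall u : L, u \in E <->
        exists e : nat, exists A B : {mpoly K[3]},
          [/\ A \is e.-homog, B \is e.-homog, eval_at xi B != 0 &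
              u = eval_at xi A / eval_at xi B],
      eval_at xi (tnth (projection M) 1) != 0 &
      ratfun_t%:A = eval_at xi (tnth (projection M) 0)
                    / eval_at xi (tnth (projection M) 1)].

Definition galois_closure (E N : {subfield L}) : Prop :=
  [/\ (E <= N)%VS, galois 1 N &
      forall N' : {subfield L}, (E <= N')%VS -> galois 1 N' -> (N <= N')%VS].

End Extensions.

End PlaneCurve.

(* Main.v *)
Require Import Defs.
From HB Require Import structures.
From mathcomp Require Import all_boot all_order all_algebra.
From mathcomp Require Import all_fingroup all_solvable all_field.
From mathcomp Require Import generic_quotient.

(* G[P] is the group A of K(t)-automorphisms of the function field E = K(C): an
   element of G[P] acts on E by pullback, and conversely the images of the
   affine coordinates of the generic point under an element of A give a rational
   map once denominators are cleared. The rest is Galois theory. Let G be the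
   Galois group of the closure of E and H the stabiliser of E, a subgroup of
   index 2n with trivial core.
   If |A| = n, the stabiliser N of the fixed field of A has index 2 in G, and H
   is normal of index n in N but not normal in G. As H and its conjugate H^g
   outside N intersect in the core, |H| = n and N = H x H^g. For h generating H
   and an involution s, the subgroup generated by h h^s is a direct factor of G,
   with the dihedral group generated by h (h^s)^-1 and s as a complement.
   Conversely, |G| = 2n^2 forces |H| = n, so H is normal in an (abelian) Sylow
   n-subgroup N, and E has degree n over the fixed field of N, hence n divides
   |A|. Moreover |A| divides 2n, and it is not 2n as H is not normal in G. *)

Set Implicit Arguments.
Unset Strict Implicit.
Unset Printing Implicit Defensive.

Import GRing.Theory.

(** * Groups of order 2n^2 with a core-free subgroup of index 2n *)

Section WreathProduct.
Local Open Scope group_scope.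
(** The quotient has order 2, so [x] and [y] both map to its only nontrivial element. *)
Lemma index2_mulV (gT : finGroupType) (G N : {group gT}) x y :
  N <| G -> #|G : N| = 2 -> x \in G :\: N -> y \in G :\: N ->
  x * y^-1 \in N.
Proof.
move=> nNG iN /setDP[Gx Nx] /setDP[Gy Ny].
have nN z : z \in G -> z \in 'N(N) by apply: subsetP; apply: normal_norm.
have ntN z : z \in G -> z \notin N -> coset N z \in (G / N)^#.
  move=> Gz Nz; rewrite !inE mem_quotient // andbT.
  by apply: contra Nz => /eqP/coset_idr; apply; apply: nN.
have: #|(G / N)^#| == 1%N.
  have:= cardsD1 1 (G / N).
  by rewrite group1 card_quotient ?normal_norm // iN => -[] /esym/eqP.
case/cards1P => c def_c.
have := ntN _ Gx Nx; have := ntN _ Gy Ny.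
rewrite def_c !inE => /eqP cy /eqP cx.
apply: coset_idr; first by rewrite groupM ?groupV ?nN.
by rewrite morphM ?morphV ?groupV ?nN //= cx cy mulgV.
Qed.

(** Conjugation by [s] swaps [h] and [k], so it fixes [z = h * k] and inverts [a = h * k^-1]. Thus
    [a] and [s] generate a dihedral group centralised by [z], and counting shows that the product is
    direct and fills [G]. *)
Lemma isog_cyclic_dihedral (gT : finGroupType) (G N : {group gT}) h s n :
  prime n -> odd n -> abelian N -> N <| G -> #|G| = (2 * n ^ 2)%N ->
  #|N| = (n ^ 2)%N -> h \in N -> #[h] = n -> s \in G -> #[s] = 2 ->
  h ^ s \notin <[h]> -> G \isog setX (Zp n) 'D_(2 * n).
Proof.
move=> n_pr n_odd cNN nNG oG oN Nh oh Gs os.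
set k := h ^ s => kH.
have Nk : k \in N.
  by rewrite memJ_norm //; apply: subsetP Gs; apply: normal_norm.
have ks : k ^ s = h.
  by rewrite -conjgM -[s * s]/(s ^+ 2) -os expg_order conjg1.
have chk : commute h k by apply: (centsP cNN).
pose z := h * k; pose a := h * k^-1.
have ok : #[k] = n by rewrite orderJ.
have hn1 : h ^+ n = 1 by rewrite -oh expg_order.
have kn1 : k ^+ n = 1 by rewrite -ok expg_order.
have zs : z ^ s = z by rewrite conjMg ks.
have as_ : a ^ s = a^-1 by rewrite conjMg conjVg ks invMg invgK.
have order_n (x : gT) : x ^+ n = 1 -> x != 1 -> #[x] = n.
  by move=> x1 ntx; apply: nt_prime_order.
have oz : #[z] = n.
  apply: order_n; first by rewrite expgMn // hn1 kn1 mulg1.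
  apply: contra kH => /eqP/(canRL (mulKg _)) ->.
  by rewrite mulg1 groupV cycle_id.
have oa : #[a] = n.
  apply: order_n.
    by rewrite expgMn ?expVgn ?hn1 ?kn1 ?invg1 ?mulg1 //; apply: commuteV.
  apply: contra kH => /eqP/(canRL (mulgK _)).
  by rewrite mul1g invgK => <-; apply: cycle_id.
pose D := <[a]> <*> <[s]>.
have nas : <[s]> \subset 'N(<[a]>).
  rewrite cycle_subG; apply/normP; rewrite -cycleJ as_.
  by apply/eqP; rewrite cycleV.
have oD : #|D| = (2 * n)%N.
  rewrite /D norm_joinEr // coprime_cardMg -?orderE ?oa ?os 1?mulnC //.
  by rewrite coprime_sym coprime2n.
have Na : a \in N by rewrite groupM ?groupV.
have Nz : z \in N by rewrite groupM.
have cza : commute z a by apply: (centsP cNN).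
have czs : commute z s by apply/commgP/conjg_fixP.
have cZD : D \subset 'C(<[z]>).
  rewrite join_subG !cycle_subG /= cent_cycle.
  by apply/andP; split; apply/cent1P; apply: commute_sym.
(* As n is odd, [x] is the power of [x ^+ 2] with exponent (n + 1) / 2. *)
have h2 (x : gT) : #[x] = n -> x \in <[x ^+ 2]>.
  move=> ox; rewrite -[X in X \in _](_ : (x ^+ 2) ^+ n.+1./2 = x) ?mem_cycle //.
  by rewrite -expgM mul2n halfK /= n_odd subn0 expgS -ox expg_order mulg1.
pose W := (<[z]> <*> D)%G.
have Wz : z \in W by rewrite mem_gen // inE cycle_id.
have Wa : a \in W by rewrite mem_gen // inE orbC mem_gen // inE cycle_id.
have Ws : s \in W by rewrite mem_gen // inE orbC mem_gen // inE cycle_id orbT.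
have Wh : h \in W.
  suff Wh2 : h ^+ 2 \in W.
    by rewrite -cycle_subG in Wh2; exact: (subsetP Wh2 _ (h2 _ oh)).
  suff -> : h ^+ 2 = z * a by rewrite groupM.
  by rewrite /z chk /a mulgA -(mulgA k) (commuteX 2 (commute_sym chk)) mulgK.
have Wk : k \in W by rewrite groupJ.
have oHK : #|<[h]> * <[k]>| = (n ^ 2)%N.
  have TI : <[h]> :&: <[k]> = 1.
    by rewrite setIC prime_TIg -?orderE ?ok // cycle_subG.
  by rewrite TI_cardMg // -!orderE oh ok.
(* The order is divisible by 2 because of [s], and by n^2 because [W] contains [<[h]> * <[k]>],
   which is [N]. *)
have oW : (2 * n ^ 2 <= #|W|)%N.
  apply: dvdn_leq; first exact: cardG_gt0.
  rewrite Gauss_dvd ?coprime2n ?oddX ?n_odd ?orbT //; apply/andP; split.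
    by rewrite -os order_dvdG.
  have sNW : N \subset W.
    suff <- : <[h]> * <[k]> = N by rewrite mul_subG ?cycle_subG.
    by apply/eqP; rewrite eqEcard oHK oN leqnn mul_subG ?cycle_subG.
  by rewrite -oN cardSg.
have sWG : W \subset G.
  have sNG := subsetP (normal_sub nNG).
  by rewrite !join_subG !cycle_subG Gs !sNG.
have defG : <[z]> * D = G.
  rewrite -cent_joinEr //; apply/eqP; rewrite eqEcard sWG oG; exact: oW.
(* The orders n and 2n of the factors multiply to the order of [G]. *)
have TI : <[z]> :&: D = 1.
  apply/eqP; rewrite -[_ == _]/(_ == [set 1]) eq_sym eqEcard sub1set group1.
  rewrite cards1.
  have := mul_cardG <[z]> D; rewrite defG -orderE oz oD oG mulnCA mulnn.
  rewrite -[LHS]muln1 => /eqP; rewrite eqn_pmul2l; last first.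
    by rewrite muln_gt0 expn_gt0 (prime_gt0 n_pr).
  by move=> /eqP <-.
have n1 := prime_gt1 n_pr.
have defGd : <[z]> \x D = G by rewrite dprodE.
apply: isog_dprod defGd (setX_dprod _ _) _ _.
  apply: isog_trans _ (isog_setX1 _ _).
  rewrite isog_cyclic_card ?cycle_cyclic //=.
  rewrite -orderE oz card_Zp ?prime_gt0 // eqxx andbT.
  by rewrite prime_cyclic // card_Zp ?prime_gt0.
apply: isog_trans _ (isog_set1X _ _).
(* As [a] and [s] satisfy the dihedral presentation, [D] is an image of the dihedral group, and the
   orders agree. *)
rewrite isogEcard oD mul2n card_dihedral // leqnn andbT Grp_dihedral //.
apply/existsP; exists (a, s); rewrite /= !xpair_eqE as_.
by rewrite -{1}oa -os !expg_order !eqxx.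
Qed.

(** [N] normalises [H] and has index 2, so the only conjugates of [H] are [H] and [H :^ g], which
    meet in the trivial core. Hence |H|^2 divides |N| = n|H|, which forces |H| = n. *)
Lemma isog_cyclic_dihedral_of_core (gT : finGroupType) (G N H : {group gT}) n :
  prime n -> odd n -> N \subset G -> H <| N -> #|G : N| = 2 -> #|N : H| = n ->
  ~~ (H <| G) -> gcore H G = 1 -> G \isog setX (Zp n) 'D_(2 * n).
Proof.
move=> n_pr n_odd sNG nHN iN iH nHG core1.
have sHN := normal_sub nHN; have sHG := subset_trans sHN sNG.
have nNG : N <| G by apply: index2_normal.
have NJ x : x \in N -> H :^ x = H by move/(subsetP (normal_norm nHN))/normP.
have [g Gg ngH] : exists2 g, g \in G & H :^ g != H.
  move: nHG; rewrite /normal sHG /= => /subsetPn[g Gg].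
  by rewrite inE => ngH; exists g => //; apply: contra ngH => /eqP->.
have GNg : g \in G :\: N by rewrite inE Gg andbT; apply: contra ngH => /NJ->.
have GNJ x : x \in G :\: N -> H :^ x = H :^ g.
  move=> GNx; have NJxg := NJ _ (index2_mulV nNG iN GNx GNg).
  by rewrite -[in RHS]NJxg -conjsgM mulgKV.
have TI : H :&: H :^ g = 1.
  apply/eqP; rewrite -subG1 -core1; apply/subsetP => y /setIP[Hy Hgy].
  apply/bigcapP => x Gx; have [/NJ->//|Nx] := boolP (x \in N).
  by rewrite GNJ ?inE ?Nx.
have nHgN : H :^ g <| N.
  have /normP NgN := subsetP (normal_norm nNG) _ Gg.
  by rewrite -[X in _ <| X]NgN normalJ.
have oN : #|N| = (#|H| * n)%N by rewrite -iH Lagrange.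
have sHHgN : H <*> H :^ g \subset N by rewrite join_subG sHN normal_sub.
have oHHg : #|H <*> H :^ g| = (#|H| * #|H|)%N.
  rewrite norm_joinEr ?TI_cardMg ?cardJg //.
  by apply: subset_trans (normal_sub nHgN) (normal_norm nHN).
have oH : #|H| = n.
  have ntH : #|H| != 1%N.
    by rewrite -trivg_card1; apply: contra ngH => /eqP->; rewrite conjs1g.
  apply/(prime_nt_dvdP n_pr ntH).
  by have:= cardSg sHHgN; rewrite oHHg oN dvdn_pmul2l.
move: oN; rewrite oH mulnn => oN.
have oG : #|G| = (2 * n ^ 2)%N by rewrite -(Lagrange sNG) iN oN mulnC.
have cNN : abelian N by apply: card_p2group_abelian oN.
have [s Gs os] : {s | s \in G & #[s] = 2}.
  by apply: Cauchy; rewrite // oG dvdn_mulr.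
(* [N] has odd order n^2, so it contains no involution. *)
have GNs : s \in G :\: N.
  rewrite inE Gs andbT; apply/negP => /order_dvdG.
  by rewrite os oN dvdn2 oddX n_odd orbT.
have /cyclicP[h defH] : cyclic H by apply: prime_cyclic; rewrite oH.
apply: (isog_cyclic_dihedral n_pr n_odd cNN nNG oG oN (h := h) (s := s)) => //.
- by rewrite -cycle_subG -defH.
- by rewrite orderE -defH.
rewrite -defH -cycle_subG cycleJ -defH (GNJ _ GNs); apply: contra ngH => sub.
by rewrite eqEcard sub cardJg leqnn.
Qed.

(** The orders give |H| = n, so a normal [H] would make the core nontrivial. A Sylow n-subgroup
    above [H] has order n^2, hence is abelian and normalises [H]. *)
Lemma core_free_index2n (gT : finGroupType) (G H : {group gT}) n :
  prime n -> odd n -> #|G| = (2 * n ^ 2)%N -> H \subset G ->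
  #|G : H| = (2 * n)%N -> gcore H G = 1 ->
  ~~ (H <| G) /\ exists N : {group gT}, [/\ N \subset G, H <| N & #|N : H| = n].
Proof.
move=> n_pr n_odd oG sHG iH core1; have n0 := prime_gt0 n_pr.
have oH : #|H| = n.
  apply/eqP; rewrite -(eqn_pmul2r (m := 2 * n)) ?muln_gt0 ?n0 //.
  by rewrite -{1}iH Lagrange // oG mulnCA mulnn.
split.
  apply/negP => nHG; have : H \subset [1 gT].
    by rewrite -core1; apply: gcore_max => //; apply: normal_norm.
  by rewrite subG1 trivg_card1 oH => /eqP n1; rewrite n1 in n_pr.
have pH : n.-group H by rewrite /pgroup oH pnat_id.
have [N sylN sHN] := Sylow_superset sHG pH.
have oN : #|N| = (n ^ 2)%N.
  rewrite (card_Hall sylN) oG partnM ?expn_gt0 ?n0 //.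
  rewrite part_p'nat ?mul1n ?part_pnat_id ?pnatX ?pnat_id //.
  by rewrite pnatE // !inE; apply: contraL n_odd => /eqP <-.
have cNN : abelian N by apply: card_p2group_abelian oN.
exists N; split; [exact: pHall_sub sylN | by rewrite -sub_abelian_normal |].
by rewrite -divgS // oN oH -mulnn mulnK.
Qed.
End WreathProduct.

Local Open Scope ring_scope.

(** * Galois correspondence in the Galois closure *)

Section GaloisClosure.
Variables (F : fieldType) (L : splittingFieldType F) (E N : {subfield L}).
Hypothesis sEN : (E <= N)%VS.
Hypothesis galN : galois 1 N.
Hypothesis minN :
  forall N' : {subfield L}, (E <= N')%VS -> galois 1 N' -> (N <= N')%VS.
Local Notation G := 'Gal(N / 1)%G.
Local Notation H := 'Gal(N / E)%G.

(** The core is normal in [G], so its fixed field is Galois over the base; it contains [E], hence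
    also [N] by minimality. *)
Lemma gcore_gal_closure : gcore H G = 1%g.
Proof.
have sHG : H \subset G by rewrite galS ?sub1v.
have nCG := gcore_normal sHG.
have sN : (N <= fixedField (gcore_group H G))%VS.
  apply: minN; last exact: normal_fixedField_galois.
  by rewrite -galois_connection // gcore_sub.
have defC := gal_fixedField (gcore_group H G).
have: ('Gal(N / fixedField (gcore_group H G)) \subset [1 (gal_of N)])%g.
  apply: subset_trans (galS _ sN) _; apply/subsetP => x.
  rewrite gal_kHom // => /kAHomP xN; rewrite inE; apply/gal_eqP => u Nu.
  by rewrite xN // gal_id.
by rewrite defC subG1 => /eqP.
Qed.

Lemma fixedField_gal_sub : fixedField H = E.
Proof. by apply/galois_fixedField; apply: galoisS galN; rewrite sub1v. Qed.

Lemma index_gal_sub : #|G : H|%g = \dim E.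
Proof.
rewrite -dim_fixed_galois ?galS ?sub1v // fixedField_gal_sub.
by rewrite dimv1 divn1.
Qed.

Lemma card_gal_eq_isog n : prime n -> odd n -> \dim E = (2 * n)%N ->
  #|'Gal(E / 1)%g| = n <-> ('Gal(N / 1) \isog setX (Zp n) 'D_(2 * n))%g.
Proof.
move=> n_pr n_odd dimE; have n0 := prime_gt0 n_pr.
have iH : #|G : H|%g = (2 * n)%N by rewrite index_gal_sub.
have sHG : H \subset G by rewrite galS ?sub1v.
have sub1E := sub1v E.
have galE (E0 : {subfield L}) : (E0 <= N)%VS -> galois E0 N.
  by move=> sE0; apply: galoisS galN; rewrite sub1v.
have quoE (E0 : {subfield L}) : (E0 <= E)%VS -> galois E0 E ->
    (H <| 'Gal(N / E0))%g /\ #|'Gal(N / E0) : H|%g = #|'Gal(E / E0)%g|.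
  move=> sE0 /and3P[_ _ nE]; have galE0 := galE E0 (subv_trans sE0 sEN).
  have sE0EN : (E0 <= E <= N)%VS by rewrite sE0.
  have nH := normalField_normal sE0EN nE; split=> //.
  rewrite -card_quotient ?normal_norm //.
  exact: card_isog (normalField_isog galE0 sE0EN nE).
split=> [oA | isoG].
  (* By Artin's theorem E / E0 is Galois with group ['Gal(E / 1)], so [H] is normal of index n in
     ['Gal(N / E0)]. *)
  pose E0 := [aspace of fixedField 'Gal(E / 1)%g].
  have sE0 : (E0 <= E)%VS by apply: fixedField_bound.
  have [nH iNH] := quoE E0 sE0 (fixedField_galois _).
  rewrite gal_fixedField oA in iNH.
  have sNG : 'Gal(N / E0)%g \subset G by rewrite galS ?sub1v.
  apply: (@isog_cyclic_dihedral_of_core _ G 'Gal(N / E0)%G H) => //.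
  - have := iH; rewrite -(Lagrange_index sNG (normal_sub nH)) iNH => /eqP.
    by rewrite eqn_pmul2r // => /eqP.
  (* Were [H] normal, [E] would be Galois over the base, with 2n automorphisms instead of n. *)
  - apply/negP => nHG; have := normal_fixedField_galois galN nHG.
    rewrite fixedField_gal_sub => /galois_dim; rewrite dimv1 divn1 dimE oA.
    by move=> /eqP; rewrite -[X in _ == X]mul1n eqn_pmul2r.
  exact: gcore_gal_closure.
have oG : #|G| = (2 * n ^ 2)%N.
  rewrite (card_isog isoG) cardsX card_Zp // mul2n card_dihedral ?prime_gt1 //.
  by rewrite -mul2n mulnCA mulnn.
have [nHG [M [sMG nHM iM]]] :=
  core_free_index2n n_pr n_odd oG sHG iH gcore_gal_closure.
(* As [H] is normal of index n in [M], [E] is Galois of degree n over this field. *)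
pose E0 := [aspace of fixedField M].
have galE0 : galois E0 E.
  rewrite -fixedField_gal_sub; apply: normal_fixedField_galois.
    by apply: galE; apply: fixedField_bound.
  by rewrite gal_fixedField.
have sE0 : (E0 <= E)%VS by case/and3P: galE0.
have [_] := quoE E0 sE0 galE0; rewrite gal_fixedField iM => oEE0.
have /dvdnP[m oA] : (n %| #|'Gal(E / 1)%g|)%N.
  by rewrite oEE0 cardSg // galS ?sub1v.
pose E1 := [aspace of fixedField 'Gal(E / 1)%g].
have dimE1 : (#|'Gal(E / 1)%g| * \dim E1 = 2 * n)%N.
  by rewrite dim_fixedField divnK // field_dimS // fixedField_bound.
have m2 : (m %| 2)%N.
  by rewrite -(dvdn_pmul2r n0) -oA -dimE1 dvdn_mulr.
have [m1 | m1] := eqVneq m 1%N; first by rewrite oA m1 mul1n.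
have/(prime_nt_dvdP (isT : prime 2) m1) def_m := m2.
(* For m = 2 the fixed field [E1] is the base field, so [E] is Galois over it and [H] is normal in
   [G]. *)
case/negP: nHG.
have E1_1 : E1 = 1%VS :> {vspace L}.
  apply/esym/eqP; rewrite eqEdim sub1v dimv1 /=.
  by have/eqP := dimE1; rewrite oA def_m -[X in _ == X]muln1 eqn_pmul2l;
     rewrite ?muln_gt0 ?n0 // => /eqP->.
have gal1E : galois 1 E.
  by have := fixedField_galois 'Gal(E / 1)%g; rewrite [fixedField _]E1_1.
by have [] := quoE 1%AS sub1E gal1E.
Qed.
End GaloisClosure.

(** * Rational maps and the function field *)

Section Evaluation.
Variables (K : closedFieldType) (L : splittingFieldType (ratfun K)).
Implicit Types (v w : 'I_3 -> L) (G : {mpoly K[3]}) (T : 3.-tuple {mpoly K[3]}).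

HB.instance Definition _ := GRing.RMorphism.copy (@const_emb K L)
  (in_alg L \o (@tofrac {poly K} \o @polyC K)).
HB.instance Definition _ v := GRing.RMorphism.copy (@eval_at K L v)
  (mmap (@const_emb K L) v).

Lemma eq_eval_at v w G : v =1 w -> eval_at v G = eval_at w G.
Proof.
by move=> eq_vw; apply: eq_bigr => m _; rewrite (mmap1_eq m eq_vw).
Qed.

Lemma eval_atC v c : eval_at v c%:MP = const_emb L c.
Proof. exact: mmapC. Qed.

Lemma eval_atX v i : eval_at v 'X_i = v i.
Proof. by rewrite /eval_at mmapX mmap1U. Qed.

Lemma eval_atZ v c G : eval_at v (c *: G) = const_emb L c * eval_at v G.
Proof. exact: mmapZ. Qed.

Lemma eval_at_comp v G T :
  eval_at v (G \mPo T) = eval_at (fun i => eval_at v (tnth T i)) G.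
Proof.
rewrite comp_mpolyE rmorph_sum; apply: eq_bigr => m _ /=.
rewrite eval_atZ; congr (_ * _); rewrite rmorph_prod.
by apply: eq_bigr => i _; rewrite rmorphXn.
Qed.

Lemma eval_at_homog v e G c : G \is e.-homog ->
  eval_at (fun i => c * v i) G = c ^+ e * eval_at v G.
Proof.
move=> /dhomogP homG; rewrite /eval_at /mmap mulr_sumr.
apply: eq_big_seq => m /homG /= <-; rewrite mulrCA; congr (_ * _).
rewrite /mmap1 mdegE -prodrXr -big_split.
by apply: eq_bigr => i _; rewrite exprMn.
Qed.

(** The coefficients of [G] are sent into the base field, which [f] fixes. *)
Lemma eval_at_AEnd (f : 'AEnd(L)) v G :
  f (eval_at v G) = eval_at (fun i => f (v i)) G.
Proof.
rewrite /eval_at rmorph_sum; apply: eq_bigr => m _.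
rewrite rmorphM rmorph_prod /= rmorph_alg; congr (_ * _).
by apply: eq_bigr => i _; rewrite rmorphXn.
Qed.
End Evaluation.

Lemma dhomog_bigprod (R : comNzRingType) n (I : Type) (r : seq I) (P : pred I)
    (e : I -> nat) (p : I -> {mpoly R[n]}) :
  (forall i, P i -> p i \is (e i).-homog) ->
  \prod_(i <- r | P i) p i \is (\sum_(i <- r | P i) e i)%N.-homog.
Proof.
move=> homp; elim/big_rec2: _ => [|i q d Pi homq]; first exact: dhomog1.
by apply: dhomogM homq; apply: homp.
Qed.

Lemma dhomog_comp (R : comNzRingType) n k (p : {mpoly R[n]})
    (T : n.-tuple {mpoly R[k]}) d e :
  p \is d.-homog -> (forall i, tnth T i \is e.-homog) ->
  p \mPo T \is (e * d)%N.-homog.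
Proof.
move=> /dhomogP homp homT; rewrite comp_mpolyE big_seq.
apply: rpred_sum => m /homp /= <-; apply: rpredZ.
rewrite mdegE big_distrr /=; apply: dhomog_bigprod => i _.
exact: dhomogMn.
Qed.

Lemma tofrac_divE (R : idomainType) (r : {fraction R}) :
  exists p q : R, q != 0 /\ r = tofrac p / tofrac q.
Proof.
elim/quotW: r => x; exists (\n_x), (\d_x); split; first exact: denom_ratioP.
rewrite -[_^-1]/(FracField.inv _) -[RHS]/(FracField.mul _ _) !piE.
rewrite /FracField.mulf /FracField.invf.
rewrite !numden_Ratio ?oner_neq0 ?denom_ratioP //.
by rewrite mulr1 mul1r Ratio_numden.
Qed.

(** * Rational maps evaluated at the generic point *)

Section FunctionField.
Variables (K : closedFieldType) (L : splittingFieldType (ratfun K)).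
Variables (d : nat) (F : {mpoly K[3]}) (M : 'M[K]_(3, 2)).
Variables (E : {subfield L}) (xi : 'I_3 -> L).
Hypothesis homF : F \is d.-homog.
Hypothesis KC : function_field_via_projection F M E xi.

Lemma in_idealP e (G : {mpoly K[3]}) : G \is e.-homog ->
  in_ideal F G <-> eval_at xi G = 0.
Proof. by case: KC => idP _ _ _ /idP []. Qed.

Lemma curve_eval0 : eval_at xi F = 0.
Proof. by apply/(in_idealP homF); exists 1; rewrite mul1r. Qed.

Lemma in_ideal_eval0 (v : 'I_3 -> L) (G : {mpoly K[3]}) :
  in_ideal F G -> eval_at v F = 0 -> eval_at v G = 0.
Proof. by case=> H -> F0; rewrite rmorphM /= F0 mulr0. Qed.

(** The linear form in the denominator of t does not vanish at [xi]. *)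
Lemma xi_neq0 : exists i, xi i != 0.
Proof.
case: KC => _ _ nz _; apply/existsP; apply: contraR nz => /existsPn xi0.
rewrite tnth_mktuple rmorph_sum big1 ?eqxx // => j _ /=.
by rewrite eval_atZ eval_atX; have/negPn/eqP-> := xi0 j; rewrite mulr0.
Qed.

Definition form_tuple m (T : m.-tuple {mpoly K[3]}) :=
  exists e : nat, forall i, tnth T i \is e.-homog.

Lemma is_ratmapP m (T : m.-tuple {mpoly K[3]}) : is_ratmap F T <->
  form_tuple T /\ exists i, eval_at xi (tnth T i) != 0.
Proof.
split=> [[[e homT] [i nTi]] | [[e homT] [i nTi]]].
  split; [by exists e | exists i; apply/eqP => Ti0].
  by apply: nTi; apply/(in_idealP (homT i)).
split; [by exists e | exists i => /(in_idealP (homT i)) Ti0].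
by rewrite Ti0 eqxx in nTi.
Qed.

(** The 2 x 2 minors lie in the ideal exactly when they vanish at [xi]. The factor is the ratio of
    values at an index where [S] does not vanish. *)
Lemma ratmap_eqP m (T S : m.-tuple {mpoly K[3]}) : ratmap_eq F T S <->
  [/\ is_ratmap F T, is_ratmap F S & exists2 c, c != 0 &
     forall i, eval_at xi (tnth T i) = c * eval_at xi (tnth S i)].
Proof.
split=> [[rT rS TS] | [rT rS [c nzc TS]]]; split=> //; last first.
  have [[[e homT] _] [[e' homS] _]] := (rT, rS) => i j.
  have hom : tnth T i * tnth S j - tnth T j * tnth S i \is (e + e').-homog.
    by rewrite rpredB ?dhomogM.
  apply/(in_idealP hom); rewrite rmorphB !rmorphM /= !TS.
  by rewrite -!mulrA [X in c * X]mulrC subrr.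
have [[[e homT] [i Ti]] [[e' homS] [j Sj]]] :=
  ((is_ratmapP _).1 rT, (is_ratmapP _).1 rS).
have TSE k l : eval_at xi (tnth T k) * eval_at xi (tnth S l)
             = eval_at xi (tnth T l) * eval_at xi (tnth S k).
  apply/eqP; rewrite -subr_eq0 -!rmorphM -rmorphB; apply/eqP.
  exact: in_ideal_eval0 (TS k l) curve_eval0.
exists (eval_at xi (tnth T j) / eval_at xi (tnth S j)) => [|k].
  rewrite mulf_neq0 ?invr_eq0 //; apply: contraNneq (mulf_neq0 Ti Sj) => Tj0.
  by rewrite TSE Tj0 mul0r.
by rewrite mulrAC -TSE mulfK.
Qed.

Lemma form_tuple_comp m (T : m.-tuple {mpoly K[3]}) S :
  form_tuple T -> form_tuple S -> form_tuple (ratmap_comp T S).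
Proof.
case=> e homT [e' homS]; exists (e' * e)%N => i.
by rewrite tnth_mktuple; apply: dhomog_comp.
Qed.

Lemma form_tuple_id : form_tuple (@ratmap_id K).
Proof. by exists 1%N => i; rewrite tnth_mktuple dhomogX /= mdeg1. Qed.

Lemma form_tuple_projection : form_tuple (projection M).
Proof.
exists 1%N => i; rewrite tnth_mktuple; apply: rpred_sum => j _.
by apply: rpredZ; rewrite dhomogX /= mdeg1.
Qed.

Lemma is_ratmap_id : is_ratmap F (@ratmap_id K).
Proof.
apply/is_ratmapP; split; first exact: form_tuple_id.
by have [i nz] := xi_neq0; exists i; rewrite tnth_mktuple eval_atX.
Qed.

Lemma is_ratmap_projection : is_ratmap F (projection M).
Proof.
apply/is_ratmapP; split; first exact: form_tuple_projection.
by case: KC => _ _ nz _; exists 1.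
Qed.

Lemma eval_ratmap_comp m (T : m.-tuple {mpoly K[3]}) S i (v : 'I_3 -> L) :
  eval_at v (tnth (ratmap_comp T S) i)
    = eval_at (fun j => eval_at v (tnth S j)) (tnth T i).
Proof. by rewrite tnth_mktuple eval_at_comp. Qed.

(** * Pullback of functions by an element of G[P] *)

Section Substitution.
Variable T : 3.-tuple {mpoly K[3]}.
Hypothesis GP_T : in_GP F M T.
Let eta i := eval_at xi (tnth T i).

Lemma eval_image_curve0 : eval_at eta F = 0.
Proof.
have [[[_ FT] _] _] := GP_T.
by rewrite -eval_at_comp; apply: in_ideal_eval0 FT curve_eval0.
Qed.

(** If [B] vanishes at [eta], the image of the generic point, then [B \mPo T] vanishes on C, in
    particular at the image of [xi] under the inverse [S]; but [T] sends that point to a multiple of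
    [xi]. *)
Lemma eval_image_eq0 e (B : {mpoly K[3]}) : B \is e.-homog ->
  (eval_at eta B == 0) = (eval_at xi B == 0).
Proof.
move=> homB; have [[[[homT _] _] [S [[[homS _] FS] TS _]]] _] := GP_T.
have [e' homT'] := homT.
apply/eqP/eqP => [|/(in_idealP homB) idB]; last first.
  exact: in_ideal_eval0 idB eval_image_curve0.
rewrite -eval_at_comp => /(in_idealP (dhomog_comp homB homT')) idBT.
have [_ _ [c nzc TSxi]] := (ratmap_eqP _ _).1 TS.
have Sxi0 : eval_at (fun i => eval_at xi (tnth S i)) F = 0.
  by rewrite -eval_at_comp; apply: in_ideal_eval0 FS curve_eval0.
have := in_ideal_eval0 idBT Sxi0; rewrite eval_at_comp.
rewrite (@eq_eval_at _ _ _ (fun i => c * xi i)); last first.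
  by move=> i; rewrite -eval_ratmap_comp TSxi tnth_mktuple eval_atX.
rewrite (eval_at_homog _ _ homB) => /eqP.
by rewrite mulf_eq0 expf_eq0 (negPf nzc) andbF => /eqP.
Qed.

(* The graph of the endomorphism of K(C) which is the pullback by T. *)
Definition pullback_rel u v :=
  exists e : nat, exists A B : {mpoly K[3]},
    [/\ A \is e.-homog, B \is e.-homog, eval_at xi B != 0 &
        u = eval_at xi A / eval_at xi B /\ v = eval_at eta A / eval_at eta B].

Lemma pullback_rel_mem u v : pullback_rel u v -> v \in E.
Proof.
case=> e [A [B [homA homB nzB [_ ->]]]]; case: KC => _ memE _ _.
have [[[[[e' homT] _] _] _] _] := GP_T.
apply/memE; exists (e' * e)%N, (A \mPo T), (B \mPo T).
rewrite !eval_at_comp; split=> //; try exact: dhomog_comp.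
by rewrite (eval_image_eq0 homB).
Qed.

Lemma pullback_rel_ex u : u \in E -> exists v, pullback_rel u v.
Proof.
case: KC => _ memE _ _ /memE[e [A [B [homA homB nzB ->]]]].
by exists (eval_at eta A / eval_at eta B), e, A, B.
Qed.

(** Two fractions for [u] differ by the form [A * B' - A' * B], which vanishes at [xi] and therefore
    at [eta]. *)
Lemma pullback_rel_fun u v w : pullback_rel u v -> pullback_rel u w -> v = w.
Proof.
case=> e [A [B [homA homB nzB [-> ->]]]].
case=> e' [A' [B' [homA' homB' nzB' [uE ->]]]].
have nzeB : eval_at eta B != 0 by rewrite (eval_image_eq0 homB).
have nzeB' : eval_at eta B' != 0 by rewrite (eval_image_eq0 homB').
have hom : A * B' - A' * B \is (e + e').-homog.
  by apply: rpredB; [apply: dhomogM | rewrite addnC; apply: dhomogM].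
apply/eqP; rewrite eqr_div // -subr_eq0 -!rmorphM -rmorphB.
rewrite (eval_image_eq0 hom) rmorphB !rmorphM /= subr_eq0.
by move/eqP: uE; rewrite eqr_div.
Qed.

Lemma pullback_rel_add u v u' v' :
  pullback_rel u v -> pullback_rel u' v' -> pullback_rel (u + u') (v + v').
Proof.
case=> e [A [B [homA homB nzB [-> ->]]]].
case=> e' [A' [B' [homA' homB' nzB' [-> ->]]]].
have nzeB : eval_at eta B != 0 by rewrite (eval_image_eq0 homB).
have nzeB' : eval_at eta B' != 0 by rewrite (eval_image_eq0 homB').
exists (e + e')%N, (A * B' + A' * B), (B * B').
rewrite !rmorphD !rmorphM /= mulf_neq0 // !addf_div //; split=> //.
  by apply: rpredD; [apply: dhomogM | rewrite addnC; apply: dhomogM].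
exact: dhomogM.
Qed.

Lemma pullback_rel_mul u v u' v' :
  pullback_rel u v -> pullback_rel u' v' -> pullback_rel (u * u') (v * v').
Proof.
case=> e [A [B [homA homB nzB [-> ->]]]].
case=> e' [A' [B' [homA' homB' nzB' [-> ->]]]].
exists (e + e')%N, (A * A'), (B * B').
by rewrite !rmorphM /= mulf_neq0 // !mulf_div; split=> //; apply: dhomogM.
Qed.

Lemma pullback_rel_inv u v : u != 0 ->
  pullback_rel u v -> pullback_rel u^-1 v^-1.
Proof.
move=> nzu [e [A [B [homA homB nzB [uE ->]]]]]; exists e, B, A.
rewrite uE !invf_div; split=> //; apply: contraNneq nzu => A0.
by rewrite uE A0 mul0r.
Qed.

Lemma pullback_rel_const c : pullback_rel (const_emb L c) (const_emb L c).
Proof.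
exists 0%N, c%:MP, 1; rewrite !eval_atC !rmorph1 !divr1 oner_neq0 dhomog1.
by split=> //; rewrite -alg_mpolyC rpredZ ?dhomog1.
Qed.

(** This is where [T] preserves the projection: both components are multiplied by the same [c], so
    their quotient t is unchanged. *)
Lemma pullback_rel_t : pullback_rel (ratfun_t K)%:A (ratfun_t K)%:A.
Proof.
have [_ /ratmap_eqP[_ _ [c nzc piT]]] := GP_T.
case: KC => _ _ nz tE; have [e hom] := form_tuple_projection.
exists e, (tnth (projection M) 0), (tnth (projection M) 1); split=> //.
split=> //; rewrite /eta -!eval_ratmap_comp !piT tE.
by rewrite -mulf_div divff ?mul1r.
Qed.

(** Constants and t generate K(t): Horner induction treats polynomials, and fractions follow. *)
Lemma pullback_rel_scalar r : pullback_rel r%:A r%:A.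
Proof.
have algM (a b : ratfun K) : (a * b)%:A = a%:A * b%:A :> L.
  exact: (rmorphM (in_alg L)).
have algV (a : ratfun K) : a^-1%:A = a%:A^-1 :> L.
  exact: (fmorphV (in_alg L)).
have rel_poly p :
    pullback_rel (tofrac p : ratfun K)%:A (tofrac p : ratfun K)%:A.
  elim/poly_ind: p => [|p c IHp].
    by rewrite -(polyC0 K); apply: pullback_rel_const.
  rewrite tofracD tofracM scalerDl algM.
  apply: pullback_rel_add (pullback_rel_const c).
  exact: pullback_rel_mul pullback_rel_t.
have [p [q [nzq ->]]] := tofrac_divE r.
rewrite algM algV.
apply: pullback_rel_mul => //; apply: pullback_rel_inv => //.
by rewrite scaler_eq0 oner_eq0 orbF tofrac_eq0.
Qed.

(* Choosing images of the elements of a basis of K(C) avoids the axiom of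
   choice. *)
Lemma pullback_hom : exists f : 'End(L), {in E, forall u, pullback_rel u (f u)}.
Proof.
have /fin_all_exists[w relw] (i : 'I_(\dim E)) :
    exists v, pullback_rel (vbasis E)`_i v.
  by apply: pullback_rel_ex; rewrite vbasis_mem ?mem_nth ?size_tuple.
pose f u := \sum_i coord (vbasis E) i u *: w i.
have linf : linear f.
  move=> c u v; rewrite /f scaler_sumr -big_split; apply: eq_bigr => i _ /=.
  by rewrite linearP scalerDl scalerA.
pose flin : {linear L -> L} := HB.pack f (GRing.isLinear.Build _ _ _ _ f linf).
exists (linfun flin) => u Eu; rewrite lfunE /= {1}(coord_vbasis Eu) /f.
(* Compatibility with sums and K(t)-multiples extends the relation from the basis to [E]. *)
elim/big_ind2: _ => [|u1 v1 u2 v2|i _].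
- by have := pullback_rel_scalar 0; rewrite scale0r.
- exact: pullback_rel_add.
rewrite -mulr_algl -[in X in pullback_rel _ X]mulr_algl.
by apply: pullback_rel_mul => //; apply: pullback_rel_scalar.
Qed.

(** Since the relation is single-valued, the linear map of [pullback_hom] is multiplicative and
    fixes K(t); it also maps [E] into itself. *)
Lemma pullback_gal :
  exists x : gal_of E, {in E, forall u, pullback_rel u (x u)}.
Proof.
have [f relf] := pullback_hom.
have kHomf : kHom 1 E f.
  have f1 : f 1 = 1.
    apply: pullback_rel_fun (relf _ (mem1v E)) _.
    by have := pullback_rel_scalar 1; rewrite scale1r.
  apply/kHomP; split=> [u v Eu Ev | _ /vlineP[r ->]].
    apply: pullback_rel_fun (relf _ (memvM Eu Ev)) _.
    by apply: pullback_rel_mul; apply: relf.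
  by rewrite linearZ /= f1.
have /kAut_to_gal[x _ fx] : kAut 1 E f.
  rewrite kAutE kHomf; apply/subvP => _ /memv_imgP[u Eu ->].
  exact: pullback_rel_mem (relf u Eu).
by exists x => u Eu; rewrite -fx //; apply: relf.
Qed.

End Substitution.

(** * Correspondence between G[P] and the automorphisms of K(C) over K(t) *)

Lemma generic_point_mem i j : xi j != 0 -> xi i / xi j \in E.
Proof.
move=> nzj; case: KC => _ memE _ _; apply/memE; exists 1%N, 'X_i, 'X_j.
by rewrite !eval_atX; split; rewrite ?dhomogX /= ?mdeg1.
Qed.

Variable j0 : 'I_3.
Hypothesis nz_j0 : xi j0 != 0.
(** Affine coordinates of the generic point. Unlike the entries of [xi], they are sure to lie in
    [E], where the action of [gal_of E] is canonical. *)
Let u i := xi i / xi j0.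
Let Eu i : u i \in E. Proof. exact: generic_point_mem. Qed.
Let u_j0 : u j0 = 1. Proof. exact: divff. Qed.

(* The pullback by T is the automorphism x. *)
Definition represents (T : 3.-tuple {mpoly K[3]}) (x : gal_of E) :=
  exists2 c, c != 0 & forall i, eval_at xi (tnth T i) = c * x (u i).

Lemma in_GP_represents T : in_GP F M T -> exists x, represents T x.
Proof.
move=> GP_T; have [x relx] := pullback_gal GP_T; exists x.
have hX (i : 'I_3) : ('X_i : {mpoly K[3]}) \is 1.-homog.
  by rewrite dhomogX /= mdeg1.
have nzT : eval_at xi (tnth T j0) != 0.
  by have := eval_image_eq0 GP_T (hX j0); rewrite !eval_atX => ->.
exists (eval_at xi (tnth T j0)) => // i.
suff -> : x (u i) = eval_at xi (tnth T i) / eval_at xi (tnth T j0).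
  by rewrite mulrC divfK.
apply: (pullback_rel_fun GP_T (relx _ (Eu i))).
by exists 1%N, 'X_i, 'X_j0; rewrite !eval_atX; split.
Qed.

Lemma represents_ex x : exists2 T, form_tuple T & represents T x.
Proof.
have /fin_all_exists[e /fin_all_exists[A /fin_all_exists[B AB]]] :
    forall i, exists e, exists A B : {mpoly K[3]},
    [/\ A \is e.-homog, B \is e.-homog, eval_at xi B != 0 &
         x (u i) = eval_at xi A / eval_at xi B].
  by move=> i; case: KC => _ memE _ _; apply/memE/memv_gal.
(* Clearing denominators: each [A i] is multiplied by the other [B j]. As [A i] and [B i] share the
   degree [e i], all components have degree the sum of the [e i]. *)
exists [tuple A i * \prod_(j | j != i) B j | i < 3].
  exists (\sum_i e i)%N => i; rewrite tnth_mktuple.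
  have -> : (\sum_j e j = e i + \sum_(j | j != i) e j)%N by rewrite (bigD1 i).
  have [hA _ _ _] := AB i; apply: dhomogM => //.
  by apply: dhomog_bigprod => j _; case: (AB j).
exists (\prod_j eval_at xi (B j)) => [|i].
  by apply/prodf_neq0 => j _; case: (AB j).
rewrite tnth_mktuple rmorphM rmorph_prod /= [in RHS](bigD1 i) //=.
by have [_ _ nzB ->] := AB i; rewrite mulrC mulrAC mulrCA divff // mulr1 mulrC.
Qed.

Lemma represents_is_ratmap T x :
  form_tuple T -> represents T x -> is_ratmap F T.
Proof.
move=> homT [c nzc Tx]; apply/is_ratmapP; split=> //; exists j0.
by rewrite Tx u_j0 rmorph1 mulr1.
Qed.

(** The factor depends on the degree only, so it is common to all components of a tuple of forms. It
    collects the scalar of [T] and the power of [xi j0] that dehomogenises [G]. *)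
Lemma eval_represents T x e : represents T x -> exists2 c, c != 0 &
  forall G : {mpoly K[3]}, G \is e.-homog ->
  eval_at (fun i => eval_at xi (tnth T i)) G = c * x (eval_at xi G).
Proof.
case=> c nzc Tx; exists (c ^+ e * x ((xi j0)^-1 ^+ e)).
  by rewrite mulf_neq0 ?fmorph_eq0 ?expf_neq0 ?invr_eq0.
move=> G homG; rewrite (eq_eval_at G Tx) (eval_at_homog _ _ homG).
rewrite -eval_at_AEnd -mulrA -rmorphM -(eval_at_homog _ _ homG).
by congr (_ * x _); apply: eq_eval_at => i; rewrite /u mulrC.
Qed.

(** Pullback reverses composition, but the product [x * y] applies [x] first, so the order is
    kept. *)
Lemma represents_comp T S x y : form_tuple T ->
  represents T x -> represents S y -> represents (ratmap_comp T S) (x * y)%g.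
Proof.
case=> e homT [c nzc Tx] /(eval_represents e)[b nzb Sy].
exists (b * y c) => [|i]; first by rewrite mulf_neq0 ?fmorph_eq0.
by rewrite eval_ratmap_comp Sy // Tx galM // rmorphM mulrA.
Qed.

Lemma represents_eq T S x y : in_GP F M T -> in_GP F M S ->
  represents T x -> represents S y -> ratmap_eq F T S <-> x = y.
Proof.
move=> [[[rT _] _] _] [[[rS _] _] _] [c nzc Tx] [b nzb Sy]; split; last first.
  move=> eq_xy; rewrite -{}eq_xy in Sy; apply/ratmap_eqP; split=> //.
  exists (c / b) => [|i]; first by rewrite mulf_neq0 ?invr_eq0.
  by rewrite Tx Sy mulrA divfK.
case/ratmap_eqP=> _ _ [a nza TS].
have eq_u i : x (u i) = y (u i).
  have TSu k : c * x (u k) = a * b * y (u k) by rewrite -Tx TS Sy mulrA.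
  (* At [j0] the affine coordinate is 1, which identifies the scalars [c] and [a * b]. *)
  have := TSu j0; rewrite u_j0 !rmorph1 !mulr1 => cE.
  by apply: (mulfI nzc); rewrite TSu cE.
apply/eqP/gal_eqP => z; case: KC => _ memE _ _.
move=> /memE[e [A [B [homA homB _ ->]]]].
(* Dehomogenising: the power of [xi j0] cancels in a quotient of forms of equal degree, so the
   action on the [u i] determines the action on [E]. *)
have evalE (f : 'AEnd(L)) (G : {mpoly K[3]}) : G \is e.-homog ->
    f (eval_at xi G) = f (xi j0 ^+ e) * eval_at (fun i => f (u i)) G.
  move=> homG; rewrite -eval_at_AEnd -rmorphM -(eval_at_homog _ _ homG).
  by congr (f _); apply: eq_eval_at => i; rewrite mulrC divfK.
rewrite !fmorph_div /= !(evalE _ _ homA) !(evalE _ _ homB).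
rewrite -!mulf_div !divff ?fmorph_eq0 ?expf_neq0 //.
by congr (_ * (_ / _)); apply: eq_eval_at.
Qed.

Lemma represents_selfmap T x :
  form_tuple T -> represents T x -> rat_selfmap F T.
Proof.
move=> homT Tx; split; first exact: represents_is_ratmap Tx.
have [e homT'] := homT; have [c _ evalT] := eval_represents d Tx.
apply/(in_idealP (dhomog_comp homF homT')).
by rewrite eval_at_comp evalT // curve_eval0 rmorph0 mulr0.
Qed.

Lemma represents_id T :
  form_tuple T -> represents T 1%g -> ratmap_eq F T (@ratmap_id K).
Proof.
move=> homT T1; have [c nzc Tu] := T1; apply/ratmap_eqP; split.
- exact: represents_is_ratmap T1.
- exact: is_ratmap_id.
exists (c / xi j0) => [|i]; first by rewrite mulf_neq0 ?invr_eq0.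
by rewrite Tu gal_id tnth_mktuple eval_atX mulrAC -mulrA.
Qed.

(** A representative of [x^-1] provides the inverse map, and the projection is preserved because [x]
    fixes t. *)
Lemma represents_in_GP T x : form_tuple T -> represents T x -> in_GP F M T.
Proof.
move=> homT Tx; have [S homS Sx] := represents_ex x^-1%g.
split.
  split; first exact: represents_selfmap Tx.
  exists S; split; first exact: represents_selfmap Sx.
    apply: represents_id; first exact: form_tuple_comp.
    by rewrite -(mulgV x); apply: represents_comp.
  apply: represents_id; first exact: form_tuple_comp.
  by rewrite -(mulVg x); apply: represents_comp.
have [e hompi] := form_tuple_projection.
have [c nzc piT] := eval_represents e Tx.
case: KC => _ _; set p1 := eval_at xi _; set p0 := eval_at xi _ => nz1 tE.
have cE : exists2 c', c' != 0 & forall i, 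
    eval_at xi (tnth (ratmap_comp (projection M) T) i)
      = c' * eval_at xi (tnth (projection M) i).
  (* The factor is read off the second component; the first agrees because p0 = t p1 and [x] fixes
     t. *)
  exists (c * x p1 / p1) => [|i].
    by rewrite !mulf_neq0 ?invr_eq0 ?fmorph_eq0.
  rewrite eval_ratmap_comp piT //.
  have p0E : p0 = (ratfun_t K)%:A * p1 by rewrite tE divfK.
  have i01 : i = 0 \/ i = 1.
    by case: i => -[|[|//]] ?; [left | right]; apply: val_inj.
  case: i01 => ->; last by rewrite -/p1 divfK.
  rewrite -/p0 p0E rmorphM /= rmorph_alg.
  by rewrite -[RHS]mulrA [p1^-1 * _]mulrCA mulVf // mulr1 [RHS]mulrAC mulrA.
apply/ratmap_eqP; split=> //; last exact: is_ratmap_projection.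
apply/is_ratmapP; split.
  exact: form_tuple_comp form_tuple_projection homT.
by have [c' nzc' TE] := cE; exists 1; rewrite TE mulf_neq0.
Qed.

End FunctionField.

(** Representation is a bijection between classes of maps under [ratmap_eq] and automorphisms of
    [E], so an enumeration of either side gives one of the other. *)
Lemma card_GP_gal (K : closedFieldType) (L : splittingFieldType (ratfun K)) d
    (F : {mpoly K[3]}) (M : 'M[K]_(3, 2)) (E : {subfield L}) (xi : 'I_3 -> L) m :
  F \is d.-homog -> function_field_via_projection F M E xi ->
  card_GP F M m <-> #|'Gal(E / 1)%g| = m.
Proof.
move=> homF KC; have [j0 nz0] := xi_neq0 KC.
have -> : #|'Gal(E / 1)%g| = #|{: gal_of E}|.
  by apply: eq_card => x; rewrite gal_kHom ?sub1v ?k1AHom.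
have repr_ex := represents_ex KC nz0.
have repr_eq := represents_eq homF KC nz0.
have repr_GP := represents_in_GP homF KC nz0.
split=> [[s [GPs s_inj s_surj]] | <-].
  have /fin_all_exists[x sx] k := in_GP_represents homF KC nz0 (GPs k).
  have x_inj : injective x.
    by move=> k l eq_x; apply/s_inj/(repr_eq _ _ _ _ _ _ (sx k) (sx l)).
  rewrite -[RHS]card_ord -(card_codom x_inj); apply: esym; apply: eq_card => y.
  have [T homT Ty] := repr_ex y; have [k Ts] := s_surj T (repr_GP _ _ homT Ty).
  rewrite inE; apply/codomP; exists k.
  by apply/(repr_eq _ _ _ _ _ _ Ty (sx k)); first exact: repr_GP Ty.
have /fin_all_exists[T T_] (x : gal_of E) :
    exists T, form_tuple T /\ represents xi j0 T x.
  by have [T] := repr_ex x; exists T.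
have GPT x : in_GP F M (T x) by have [homT Tx] := T_ x; apply: repr_GP Tx.
exists (fun k => T (enum_val k)); split=> [k|k l|S GPS] //.
  by case/(repr_eq _ _ _ _ (GPT _) (GPT _) (T_ _).2 (T_ _).2)/enum_val_inj.
have [x Sx] := in_GP_represents homF KC nz0 GPS.
exists (enum_rank x); rewrite enum_rankK.
exact/(repr_eq _ _ _ _ GPS (GPT x) Sx (T_ x).2).
Qed.

Theorem theorem7p2 (K : closedFieldType) (charK : [pchar K] =i pred0)
    (d : nat) (d_ge4 : (4 <= d)%N)
    (F : {mpoly K[3]}) (smoothF : smooth_plane_curve d F)
    (P : 'rV[K]_3) (P_neq0 : P != 0)
    (M : 'M[K]_(3, 2)) (PM : pencil_coordinates P M)
    (L : splittingFieldType (ratfun K)) (E : {subfield L}) (xi : 'I_3 -> L)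
    (KC : function_field_via_projection F M E xi)
    (LP : {subfield L}) (LP_closure : galois_closure E LP)
    (n : nat) (n_prime : prime n) (n_odd : odd n)
    (deg_proj : \dim E = (2 * n)%N) :
  card_GP F M n <->
  ('Gal(LP / 1) \isog setX (Zp n) 'D_(2 * n))%g.
Proof.
have [homF _ _] := smoothF.
have [sELP galLP minLP] := LP_closure.
apply: iff_trans (card_GP_gal n homF KC) _.
exact: card_gal_eq_isog.
Qed.
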